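(* For every natural number $n$, every atomic base $\mathfrak{B} \in \mathbb{B}^n$, every finite set of formulas $\Gamma$ and every formula $A$ of $\mathscr{L}$: $\Gamma \models_{\mathfrak{B}, n} A$ if and only if $\Gamma \models^\alpha_{\mathfrak{B}, n} A$.
   Context: LANGUAGE. $\mathscr{L}$ is the propositional language whose formulas are built from infinitely many propositional letters and the atomic constant $\bot$ by $\wedge,\vee,\rightarrow$; $\neg X := X \rightarrow \bot$. $\mathrm{ATOM}$ is the set of the letters together with $\bot$. $\Gamma,\Delta$ always range over finite sets of formulas. ATOMIC RULES. A rule of level $0$ is an atom (an axiom). A rule of level $1$ infers an atom $A$ from atoms $A_1,\dots,A_m$. For $k\ge 1$, if $\Re_1,\dots,\Re_m$ are finite sets of atomic rules (some possibly empty) of maximal level $k-1$, then $([\Re_1]A_1,\dots,[\Re_m]A_m)/A$, which infers the atom $A$ from the atoms $A_1,\dots,A_m$ and discharges the rules in $\Re_i$ in the derivation of the $i$-th premise, is a rule of level $k+1$. ATOMIC BASES. An atomic base is a (possibly infinite) set $\mathfrak{B}$ of atomic rules containing the explosion rule $\bot/A$ for every atom $A$; its level is the maximal level of its rules other than the explosion rules ($0$ if there are none). $\mathbb{B}^n$ is the set of bases of level $\le n$. $\mathfrak{C}\supseteq_n\mathfrak{B}$ means $\mathfrak{C}\supseteq\mathfrak{B}$ and $\mathfrak{C}\in\mathbb{B}^n$. Derivations in $\mathfrak{B}$ are defined inductively: an atom $A$ is a single-node derivation of $A$, from no assumed rules if the axiom $A\in\mathfrak{B}$ is applied, and from the assumed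 rule $A$ if $A$ is assumed; if $\mathscr{D}_i$ derives $A_i$ from assumed rules $\mathfrak{C}_i\cup\Re_i$ ($i\le m$), then applying $R=([\Re_1]A_1,\dots,[\Re_m]A_m)/A$ yields a derivation of $A$ from $\bigcup_i\mathfrak{C}_i$ if $R\in\mathfrak{B}$, and from $\bigcup_i\mathfrak{C}_i\cup\{R\}$ if $R\notin\mathfrak{B}$. $\vdash_{\mathfrak{B}}A$ means that there is a derivation of $A$ in $\mathfrak{B}$ from no assumed rules (a closed derivation). STANDARD BASE SEMANTICS. For $\mathfrak{B}\in\mathbb{B}^n$, define: for $A\in\mathrm{ATOM}$, $\models_{\mathfrak{B},n}A$ iff $\vdash_{\mathfrak{B}}A$; $\models_{\mathfrak{B},n}B\wedge C$ iff $\models_{\mathfrak{B},n}B$ and $\models_{\mathfrak{B},n}C$; $\models_{\mathfrak{B},n}B\vee C$ iff $\models_{\mathfrak{B},n}B$ or $\models_{\mathfrak{B},n}C$; $\models_{\mathfrak{B},n}B\rightarrow C$ iff $B\models_{\mathfrak{B},n}C$; for $\Gamma\ne\emptyset$, $\Gamma\models_{\mathfrak{B},n}A$ iff for all $\mathfrak{C}\supseteq_n\mathfrak{B}$, if $\models_{\mathfrak{C},n}B$ for all $B\in\Gamma$ then $\models_{\mathfrak{C},n}A$. REDUCIBILITY SEMANTICS. An argument structure $\mathscr{D}=\langle T,\langle f,h,g\rangle\rangle$ consists of a finite rooted tree $T$ with nodes labelled by formulas ($\mu\prec\nu$ means that $\nu$ lies below $\mu$, towards the root), whose leaves are partitioned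 into assumption leaves $\mathrm{as}(T)$ and axiom leaves $\mathrm{ax}(T)$, and of partial discharge functions: $f$ is defined on a subset of $\mathrm{as}(T)$ with $\mu\prec f(\mu)$; $h$ is defined on a subset of $\mathrm{ax}(T)$ with $\mu\prec h(\mu)$, where $h(\mu)$ and its children are labelled by atoms and $h(\mu)$ is not a value of $f$; $g$ is defined on a set of sets $K$ of edges, each $K$ consisting of all and only the edges linking a node $\mu_K$ to its children, where $\mu_K$ and its children are labelled by atoms, $\mu_K$ is not a value of $f$, $\mu_K\prec g(K)$, $g(K)$ and its children are labelled by atoms, and $g(K)$ is not a value of $f$. ($f$ discharges assumptions; $h$ and $g$ discharge assumed atomic rules of level $0$ and higher.) The root label is the conclusion. $\mathscr{D}$ is from $\Gamma$ to $A$ if $\Gamma$ is the set of its undischarged assumptions and $A$ its conclusion; it is closed if $\Gamma=\emptyset$, open otherwise. Derivations in $\mathfrak{B}$ are regarded as argument structures with all labels atomic and $f$ empty. $\mathscr{D}[\mathscr{D}^{**}/\mathscr{D}^*]$ is the result of replacing the sub-structure $\mathscr{D}^*$ by $\mathscr{D}^{**}$ in $\mathscr{D}$, the discharge functions being redefined in the natural way (discharges of surviving or copied assumptions and assumed rules take place at the corresponding nodes; the others disappear). If $\mathscr{D}$ is from $\Gamma=\{\mu_1,\dots,\mu_m\}$ and $\sigma$ assigns to each $\mu_i$ an argument structure $\sigma(\mu_i)$ with the same conclusion as $\mu_i$, then $\mathscr{D}^\sigma=\mathscr{D}[\sigma(\mu_1),\dots,\sigma(\mu_m)/\mu_1,\dots,\mu_m]$;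 it is a closed $\sigma$-instance if all $\sigma(\mu_i)$ are closed. An inference is a triple $\langle\langle\mathscr{D}_1,\dots,\mathscr{D}_m\rangle,A,\delta\rangle$ with $\delta$ an extension of the discharge functions of the $\mathscr{D}_i$; its associated argument structure joins the trees of the $\mathscr{D}_i$ by a new root $A$ and adds the discharges $\delta$. A rule is a (recursive) set of inferences, its instances. Introduction rules are Gentzen's: $A,B/A\wedge B$; $A_i/A_1\vee A_2$ ($i=1,2$); $[A]B/A\rightarrow B$. $\mathscr{D}$ is canonical if it is associated to an instance of an introduction rule. A reduction for a rule $R$ is a map $\phi$ from and to argument structures, defined on some set $\mathbb{D}$ of argument structures associated to instances of $R$, such that for all $\mathscr{D}\in\mathbb{D}$: (a) if $\mathscr{D}$ is from $\Gamma$ to $A$, then $\phi(\mathscr{D})$ is from some $\Gamma^*\subseteq\Gamma$ to $A$; (b) for all $\sigma$, $\phi$ is defined on $\mathscr{D}^\sigma$ and $\phi(\mathscr{D}^\sigma)=\phi(\mathscr{D})^\sigma$. For a set $\mathfrak{J}$ of reductions, $\mathscr{D}\leq_{\mathfrak{J}}\mathscr{D}^*$ is the reflexive-transitive closure of: $\mathscr{D}^*=\mathscr{D}[\phi(\mathscr{D}^{**})/\mathscr{D}^{**}]$ for some sub-structure $\mathscr{D}^{**}$ of $\mathscr{D}$ and some $\phi\in\mathfrak{J}$. An argument is a pair $\langle\mathscr{D},\mathfrak{J}\rangle$. It is $n$-valid on $\mathfrak{B}\in\mathbb{B}^n$ iff: when $\mathscr{D}$ is closed with atomic conclusion, $\mathscr{D}\leq_{\mathfrak{J}}\mathscr{D}^*$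 for some closed derivation $\mathscr{D}^*$ in $\mathfrak{B}$; when $\mathscr{D}$ is closed with non-atomic conclusion, $\mathscr{D}\leq_{\mathfrak{J}}\mathscr{D}^*$ for some canonical $\mathscr{D}^*$ whose immediate sub-structures, paired with $\mathfrak{J}$, are $n$-valid on $\mathfrak{B}$; when $\mathscr{D}$ is open with undischarged assumptions $\Gamma$, for all $\sigma$ assigning closed structures, all sets of reductions $\mathfrak{J}^+\supseteq\mathfrak{J}$ and all $\mathfrak{C}\supseteq_n\mathfrak{B}$, if $\langle\sigma(\mu),\mathfrak{J}^+\rangle$ is $n$-valid on $\mathfrak{C}$ for all $\mu\in\Gamma$, then $\langle\mathscr{D}^\sigma,\mathfrak{J}^+\rangle$ is $n$-valid on $\mathfrak{C}$. $\Gamma\models^\alpha_{\mathfrak{B},n}A$ means that some argument $\langle\mathscr{D},\mathfrak{J}\rangle$ with $\mathscr{D}$ from $\Gamma$ to $A$ is $n$-valid on $\mathfrak{B}$. *)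

(* Defs.v *)
From HB Require Import structures.
From Stdlib Require List.
From Stdlib Require Import Relation_Operators.
From mathcomp Require Import all_boot finmap.
Set Implicit Arguments. Unset Strict Implicit. Unset Printing Implicit Defensive.

Local Open Scope fset_scope.

(** * Language *)

Inductive atom := Bot | Letter of nat.

Inductive form :=
  | Atom of atom
  | And of form & form
  | Or of form & form
  | Imp of form & form.

Definition neg (A : form) : form := Imp A (Atom Bot).

Fixpoint form_to_tree (A : form) : GenTree.tree nat :=
  match A with
  | Atom Bot => GenTree.Leaf 0
  | Atom (Letter p) => GenTree.Leaf p.+1
  | And B C => GenTree.Node 0 [:: form_to_tree B; form_to_tree C]
  | Or B C => GenTree.Node 1 [:: form_to_tree B; form_to_tree C]
  | Imp B C => GenTree.Node 2 [:: form_to_tree B; form_to_tree C]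
  end.

Fixpoint form_of_tree (t : GenTree.tree nat) : option form :=
  match t with
  | GenTree.Leaf 0 => Some (Atom Bot)
  | GenTree.Leaf p.+1 => Some (Atom (Letter p))
  | GenTree.Node k [:: t1; t2] =>
      if form_of_tree t1 is Some B then
        if form_of_tree t2 is Some C then
          match k with
          | 0 => Some (And B C)
          | 1 => Some (Or B C)
          | _ => Some (Imp B C)
          end
        else None
      else None
  | _ => None
  end.

Lemma form_to_treeK : pcancel form_to_tree form_of_tree.
Proof. by elim=> [[|p]||| ] //= B -> C ->. Qed.

HB.instance Definition _ := Countable.copy form (pcan_type form_to_treeK).

Definition atomic (A : form) : bool := if A is Atom _ then true else false.

(** * Atomic rules and bases *)

(* [Rule [:: (R1, A1); ...; (Rm, Am)] A] is ([R1]A1, ..., [Rm]Am)/A; the finite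
   set Ri is given by a list of its members, and [same_rule] identifies rules
   that differ only in the choice of these lists. *)
Inductive rule := Rule of seq (seq rule * atom) & atom.

Inductive same_rule : rule -> rule -> Prop :=
  SameRule ps qs A :
    List.Forall2 (fun p q =>
      [/\ p.2 = q.2,
          forall R, List.In R p.1 -> exists2 R', List.In R' q.1 & same_rule R R' &
          forall R', List.In R' q.1 -> exists2 R, List.In R p.1 & same_rule R R'])
      ps qs ->
    same_rule (Rule ps A) (Rule qs A).

Definition max_seq (s : seq nat) : nat := foldr maxn 0 s.

(* With premises, the level is 1 if nothing is discharged, and otherwise the
   maximal level of the discharged rules plus 2. *)
Fixpoint level (R : rule) : nat :=
  let: Rule ps _ := R in
  if ps is [::] then 0
  else (max_seq [seq max_seq [seq (level R').+1 | R' <- p.1] | p <- ps]).+1.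

Definition explosion (A : atom) : rule := Rule [:: ([::], Bot)] A.

Definition rule_set := rule -> Prop.

Definition atomic_base (B : rule_set) : Prop :=
  (forall R R', same_rule R R' -> B R -> B R') /\ (forall A, B (explosion A)).

(* The bases of level at most [n]. *)
Definition base_le (n : nat) (B : rule_set) : Prop :=
  atomic_base B /\
  forall R, B R -> ~ (exists A, R = explosion A) -> level R <= n.

Definition extends (n : nat) (B C : rule_set) : Prop :=
  (forall R, B R -> C R) /\ base_le n C.

(** * Argument structures *)

(* A labelled tree together with its discharge functions. [As A d] is an
   assumption leaf; [Nd A d [::]] is an axiom leaf; [Nd A d ts] with [ts] non
   empty is a node with immediate subtrees [ts]. A node is discharged only at a
   proper ancestor, so a discharge is recorded by the distance to that ancestor:
   [Some 0] is the parent, [Some 1] the grandparent, and so on; [None] means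
   that the discharge function is undefined. In [As A d], [d] is the value of f;
   in [Nd A d [::]] it is the value of h; in [Nd A d ts] it is the value of g at
   the set of edges linking the node to its children. *)
Inductive tree :=
  | As of form & option nat
  | Nd of form & option nat & seq tree.

Definition concl (t : tree) : form :=
  match t with As A _ | Nd A _ _ => A end.

(* Labels of the assumptions of [t] that f discharges at the [k]-th proper
   ancestor of the root of [t] (the parent being the 0-th). *)
Fixpoint f_labels (k : nat) (t : tree) : seq form :=
  match t with
  | As A d => if d == Some k then [:: A] else [::]
  | Nd _ _ ts => flatten [seq f_labels k.+1 u | u <- ts]
  end.

Definition f_value (ts : seq tree) : bool := has (fun t => f_labels 0 t != [::]) ts.

Fixpoint hg_at (k : nat) (t : tree) : bool :=
  match t with
  | As _ _ => false
  | Nd _ d ts => (d == Some k) || has (hg_at k.+1) ts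
  end.

Definition hg_value (ts : seq tree) : bool := has (hg_at 0) ts.

Definition within (k : nat) (d : option nat) : bool :=
  if d is Some j then j < k else true.

(* [wf_at k t]: [t] satisfies the conditions on f, h, g when its root has [k]
   proper ancestors. *)
Fixpoint wf_at (k : nat) (t : tree) : bool :=
  match t with
  | As _ d => within k d
  | Nd A d ts =>
      let rule_node := [&& atomic A, all (atomic \o concl) ts & ~~ f_value ts] in
      [&& within k d,
          (d != None) && ~~ nilp ts ==> rule_node,
          hg_value ts ==> rule_node &
          all (wf_at k.+1) ts]
  end.

Definition arg_structure (D : tree) : bool := wf_at 0 D.

(* Discharges leading outside [t] dropped: the sub-structure at the root of the
   subtree [t]. *)
Fixpoint trunc_at (k : nat) (t : tree) : tree :=
  match t with
  | As A d => As A (if within k d then d else None)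
  | Nd A d ts => Nd A (if within k d then d else None) [seq trunc_at k.+1 u | u <- ts]
  end.

Definition substructure (t : tree) : tree := trunc_at 0 t.

Definition immediate (D : tree) : seq tree :=
  if D is Nd _ _ ts then [seq substructure t | t <- ts] else [::].

(* [d] is the discharge of a node with [k] proper ancestors in some subtree;
   lists [x] with the ancestor of the subtree where that node is discharged
   ([None] if nowhere), unless it is discharged inside the subtree. *)
Definition outward (X : Type) (k : nat) (x : X) (d : option nat) : seq (X * option nat) :=
  match d with
  | None => [:: (x, None)]
  | Some j => if j < k then [::] else [:: (x, Some (j - k))]
  end.

(* The assumptions of a subtree not discharged inside it. *)
Fixpoint open_as (k : nat) (t : tree) : seq (form * option nat) :=
  match t with
  | As A d => outward k A d
  | Nd _ _ ts => flatten [seq open_as k.+1 u | u <- ts]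
  end.

(* The applications of axioms and of atomic rules in a subtree that are not
   discharged inside it, identified by the labels of conclusion and premises. *)
Fixpoint open_rules (k : nat) (t : tree) : seq ((form * seq form) * option nat) :=
  match t with
  | As _ _ => [::]
  | Nd A d ts =>
      (if f_value ts then [::] else outward k (A, [seq concl u | u <- ts]) d)
      ++ flatten [seq open_rules k.+1 u | u <- ts]
  end.

Definition asm (D : tree) : {fset form} := [fset A in unzip1 (open_as 0 D)].

Definition from_to (D : tree) (Gamma : {fset form}) (A : form) : Prop :=
  asm D = Gamma /\ concl D = A.

Definition closed (D : tree) : bool := asm D == fset0.

(** * Derivations in a base *)

(* [ctx] lists the sets of rules discharged, on the branch at hand, at the
   successive proper ancestors of the root. An application of a rule is either
   undischarged, and then of a rule of [B], or discharged at an ancestor, and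
   then of a rule in the set discharged there. *)
Inductive derivation (B : rule_set) : seq (seq rule) -> tree -> Prop :=
  Derivation ctx ps A d ts :
    (if d is Some j then List.In (Rule ps A) (nth [::] ctx j) else B (Rule ps A)) ->
    List.Forall2 (fun p t => concl t = Atom p.2 /\ derivation B (p.1 :: ctx) t) ps ts ->
    derivation B ctx (Nd (Atom A) d ts).

Definition closed_derivation (B : rule_set) (D : tree) : Prop := derivation B [::] D.

Definition derivable (B : rule_set) (A : atom) : Prop :=
  exists2 D, closed_derivation B D & concl D = Atom A.

(** * Standard base semantics *)

Fixpoint sat (n : nat) (B : rule_set) (A : form) : Prop :=
  match A with
  | Atom a => derivable B a
  | And X Y => sat n B X /\ sat n B Y
  | Or X Y => sat n B X \/ sat n B Y
  | Imp X Y => forall C, extends n B C -> sat n C X -> sat n C Y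
  end.

Definition entails (n : nat) (B : rule_set) (Gamma : {fset form}) (A : form) : Prop :=
  if Gamma == fset0 then sat n B A
  else forall C, extends n B C -> (forall X, X \in Gamma -> sat n C X) -> sat n C A.

(** * Substitution *)

Fixpoint subst (sigma : form -> tree) (t : tree) : tree :=
  match t with
  | As A None => sigma A
  | As A (Some j) => As A (Some j)
  | Nd A d ts => Nd A d [seq subst sigma u | u <- ts]
  end.

(* Only the values of [sigma] on the members of [Gamma] are relevant. *)
Definition assigns (Gamma : {fset form}) (sigma : form -> tree) : Prop :=
  forall A, A \in Gamma -> arg_structure (sigma A) /\ concl (sigma A) = A.

(** * Inferences and rules *)

(* The inference <<D1, ..., Dm>, A, delta> is represented by [([:: t1; ...; tm], A)]
   where [ti] is [Di] together with the discharges that [delta] adds at the new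
   root; thus [Di = substructure ti]. *)
Definition inference := (seq tree * form)%type.

Definition associated (i : inference) : tree := Nd i.2 None i.1.

Inductive recfun :=
  | Zero | Succ | Proj of nat
  | Comp of recfun & seq recfun
  | Prec of recfun & recfun
  | Mu of recfun.

(* [computes f s y]: the partial recursive function [f] has value [y] at [s]. *)
Inductive computes : recfun -> seq nat -> nat -> Prop :=
  | CZero s : computes Zero s 0
  | CSucc x s : computes Succ (x :: s) x.+1
  | CProj i s : i < size s -> computes (Proj i) s (nth 0 s i)
  | CComp f gs s ys y :
      List.Forall2 (fun g z => computes g s z) gs ys -> computes f ys y ->
      computes (Comp f gs) s y
  | CPrec0 f g s y : computes f s y -> computes (Prec f g) (0 :: s) y
  | CPrecS f g x s z y :
      computes (Prec f g) (x :: s) z -> computes g [:: x, z & s] y ->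
      computes (Prec f g) (x.+1 :: s) y
  | CMu f x s :
      computes f (x :: s) 0 ->
      (forall z, z < x -> exists y, computes f (z :: s) y.+1) ->
      computes (Mu f) s x.

Fixpoint code_tree (t : tree) : nat :=
  match t with
  | As A d => CodeSeq.code [:: 0; choice.pickle A; choice.pickle d]
  | Nd A d ts => CodeSeq.code [:: 1, choice.pickle A, choice.pickle d & [seq code_tree u | u <- ts]]
  end.

Definition code_inference (i : inference) : nat :=
  CodeSeq.code (choice.pickle i.2 :: [seq code_tree t | t <- i.1]).

Definition recursive (R : inference -> Prop) : Prop :=
  exists f, forall i, (R i -> computes f [:: code_inference i] 1)
                   /\ (~ R i -> computes f [:: code_inference i] 0).

(* Instances of Gentzen's introduction rules. *)
Definition introduction (i : inference) : bool :=
  [&& arg_structure (associated i), ~~ hg_value i.1 &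
    match i with
    | ([:: t; u], And A B) => [&& concl t == A, concl u == B & ~~ f_value i.1]
    | ([:: t], Or A B) => ((concl t == A) || (concl t == B)) && ~~ f_value i.1
    | ([:: t], Imp A B) => (concl t == B) && all (pred1 A) (f_labels 0 t)
    | _ => false
    end].

Definition canonical (D : tree) : Prop :=
  exists2 i, introduction i & D = associated i.

(** * Reductions *)

(* A map defined on some set of structures is a partial map. *)
Definition reduction_map := tree -> option tree.

Definition reduction_for (R : inference -> Prop) (phi : reduction_map) : Prop :=
  forall D E, phi D = Some E ->
    [/\ arg_structure D, arg_structure E,
        exists2 i, R i & D = associated i,
        asm E `<=` asm D /\ concl E = concl D &
        forall sigma, assigns (asm D) sigma ->
          phi (subst sigma D) = Some (subst sigma E)].

Definition reduction (phi : reduction_map) : Prop :=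
  exists2 R, recursive R & reduction_for R phi.

Definition map_set := reduction_map -> Prop.

Definition reductions (J : map_set) : Prop := forall phi, J phi -> reduction phi.

(* [s] lists what is open in the replaced subtree and where it is discharged,
   [s'] does so for the replacing one. An item of [s'] is a copy of one with the
   same labels in [s], if there is any, and is then discharged where that one is;
   otherwise it is undischarged. When several items of [s] have these labels,
   each of them may be the one that is copied. *)
Definition inherits (X : eqType) (s s' : seq (X * option nat)) : Prop :=
  forall x, x \in s' -> x \in s \/ (x.1 \notin unzip1 s /\ x.2 = None).

(* The subtree [t'] replaces [t] as the result of replacing the sub-structure at
   [t] by the argument structure [E]. *)
Definition replaces (E t t' : tree) : Prop :=
  [/\ substructure t' = E,
      inherits (open_as 0 t) (open_as 0 t') &
      inherits (open_rules 0 t) (open_rules 0 t')].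

Inductive in_context (P : tree -> tree -> Prop) : tree -> tree -> Prop :=
  | ICHere t t' : P t t' -> in_context P t t'
  | ICBelow A d us vs t t' :
      in_context P t t' ->
      in_context P (Nd A d (us ++ t :: vs)) (Nd A d (us ++ t' :: vs)).

Definition reduces1 (J : map_set) (D D' : tree) : Prop :=
  arg_structure D' /\
  in_context (fun t t' => exists phi E,
    [/\ J phi, phi (substructure t) = Some E & replaces E t t']) D D'.

Definition reduces (J : map_set) : tree -> tree -> Prop :=
  clos_refl_trans_1n tree (reduces1 J).

(** * Validity *)

(* The clauses defining n-validity, in terms of the n-validity [V] of other
   arguments. *)
Definition validity_clauses (n : nat) (V : rule_set -> map_set -> tree -> Prop)
    (B : rule_set) (J : map_set) (D : tree) : Prop :=
  if closed D then
    if atomic (concl D) then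
      exists2 E, reduces J D E & closed_derivation B E
    else
      exists E, [/\ reduces J D E, canonical E & List.Forall (V B J) (immediate E)]
  else
    forall (sigma : form -> tree) (J' : map_set) (C : rule_set),
      assigns (asm D) sigma -> (forall A, A \in asm D -> closed (sigma A)) ->
      reductions J' -> (forall phi, J phi -> J' phi) -> extends n B C ->
      (forall A, A \in asm D -> V C J' (sigma A)) ->
      V C J' (subst sigma D).

Fixpoint height (A : form) : nat :=
  match A with
  | Atom _ => 0
  | And X Y | Or X Y | Imp X Y => (maxn (height X) (height Y)).+1
  end.

(* The clauses reduce the validity of an argument to that of arguments whose
   structures have smaller rank. *)
Definition rank (D : tree) : nat :=
  (max_seq [seq height A | A <- concl D :: unzip1 (open_as 0 D)]).*2 + ~~ closed D.

Definition valid (n : nat) (B : rule_set) (J : map_set) (D : tree) : Prop :=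
  iter (rank D).+1 (validity_clauses n) (fun _ _ _ => False) B J D.

Definition arg_entails (n : nat) (B : rule_set) (Gamma : {fset form}) (A : form) : Prop :=
  exists D J, [/\ arg_structure D, reductions J, from_to D Gamma A & valid n B J D].

(** * The clauses hold of [valid]: see [validE] *)

Lemma tree_nested_ind (P : tree -> Prop) :
  (forall A d, P (As A d)) ->
  (forall A d ts, List.Forall P ts -> P (Nd A d ts)) -> forall t, P t.
Proof.
move=> HA HN; fix IH 1 => -[A d|A d ts]; first exact: HA.
apply: HN; elim: ts => [|t ts IHts]; constructor; [exact: IH|exact: IHts].
Qed.

Definition shift X k (s : seq (X * option nat)) :=
  flatten [seq outward k x.1 x.2 | x <- s].

Lemma outwardD X k m (x : X) d : outward (m + k) x d = shift k (outward m x d).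
Proof.
case: d => [j|] //=; rewrite /shift; case: (ltnP j m) => [h|h] /=.
  by rewrite (leq_trans h (leq_addr _ _)).
by rewrite cats0 ltn_subLR // subnDA.
Qed.

Lemma shift_cat X k (s1 s2 : seq (X * option nat)) :
  shift k (s1 ++ s2) = shift k s1 ++ shift k s2.
Proof. by rewrite /shift map_cat flatten_cat. Qed.

Lemma open_asD k t m : open_as (m + k) t = shift k (open_as m t).
Proof.
elim/tree_nested_ind: t m => [A d|A d ts IH] m /=; first exact: outwardD.
by elim: IH => //= u us Hu _ ->; rewrite shift_cat -Hu.
Qed.

Lemma unzip1_open_as_trunc k t :
  unzip1 (open_as k (trunc_at k t)) = unzip1 (open_as k t).
Proof.
elim/tree_nested_ind: t k => [A [j|]|A d ts IH] k //=.
  by case: (ltnP j k) => [lt|ge] /=; rewrite ?lt // ltnNge ge.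
by elim: IH => //= u us Hu _ IHus; rewrite /unzip1 !map_cat; congr (_ ++ _); [exact: Hu|].
Qed.

Lemma concl_trunc k t : concl (trunc_at k t) = concl t.
Proof. by case: t. Qed.

Lemma in_asm D A : (A \in asm D) = (A \in unzip1 (open_as 0 D)).
Proof. by rewrite /asm !inE. Qed.

Lemma closedE D : closed D = (open_as 0 D == [::]).
Proof.
apply/eqP/eqP => [h|h]; last by rewrite /asm h /=; apply/fsetP => A; rewrite !inE.
case E: (open_as 0 D) => [//|x s].
by have := in_asm D x.1; rewrite h E /= !inE eqxx.
Qed.

Lemma mem_shift (X : eqType) k (s s' : seq (X * option nat)) :
  {subset s' <= s} -> {subset shift k s' <= shift k s}.
Proof.
move=> h x /flattenP [l /mapP [y /h ys ->] xl].
by apply/flattenP; exists (outward k y.1 y.2) => //; apply: map_f.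
Qed.

Lemma replaces_open (D E t t' : tree) :
  asm E `<=` asm (substructure t) -> replaces E t t' ->
  {subset open_as 0 t' <= open_as 0 t}.
Proof.
move=> /fsubsetP hs [hE ho _] x xt'; case: (ho x xt') => [//|[/negP[]]].
rewrite -unzip1_open_as_trunc -in_asm; apply: hs.
by rewrite -hE in_asm unzip1_open_as_trunc; apply: map_f.
Qed.

Lemma reduces1_inv J D D' : reductions J -> reduces1 J D D' ->
  [/\ arg_structure D', concl D' = concl D & {subset open_as 0 D' <= open_as 0 D}].
Proof.
move=> hJ [wD' ctx]; split=> //.
  elim: ctx => // t t' [phi [E [/hJ [R _ hR] hphi [h1 _ _]]]].
  have [_ _ _ [_ hc] _] := hR _ _ hphi.
  by rewrite -h1 /substructure !concl_trunc in hc.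
elim: ctx => [t t' [phi [E [/hJ [R _ hR] hphi hrep]]]|A d us vs t t' _ IH] /=.
  have [_ _ _ [ha _] _] := hR _ _ hphi.
  exact: replaces_open ha hrep.
move=> x; rewrite !map_cat !flatten_cat !mem_cat.
case/or3P => [->//|h|->]; last by rewrite !orbT.
apply/or3P/Or32; move: h; rewrite -[1]add0n !open_asD.
exact: mem_shift.
Qed.

Lemma reduces_inv J D E : reductions J -> reduces J D E -> arg_structure D ->
  [/\ arg_structure E, concl E = concl D & {subset open_as 0 E <= open_as 0 D}].
Proof.
move=> hJ; elim=> [x w|x y z h _ IH _]; first by split.
have [wy cy sy] := reduces1_inv hJ h; have [wz cz sz] := IH wy.
by split=> //; [rewrite cz|move=> u /sz /sy].
Qed.

Lemma cat_neq0 (X : eqType) (s1 s2 : seq X) :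
  (s1 ++ s2 != [::]) = (s1 != [::]) || (s2 != [::]).
Proof. by case: s1. Qed.

Lemma f_labels_trunc m k t : f_labels m (trunc_at k t) != [::] -> f_labels m t != [::].
Proof.
elim/tree_nested_ind: t m k => [A [j|]|A d ts IH] m k //=.
  by case: (ltnP j k).
elim: IH => //= u us Hu _ IHus.
by rewrite !cat_neq0 => /orP[/Hu ->//|/IHus ->]; rewrite orbT.
Qed.

Lemma hg_at_trunc m k t : hg_at m (trunc_at k t) -> hg_at m t.
Proof.
elim/tree_nested_ind: t m k => [//|A d ts IH] m k /= /orP[|h].
  by case: ifP => // _ ->.
apply/orP; right; elim: IH h => //= u us Hu _ IHus /orP[/Hu ->//|/IHus ->].
by rewrite orbT.
Qed.


Lemma has_sub (T : Type) (a b : T -> bool) s : (forall x, a x -> b x) -> has a s -> has b s.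
Proof. by move=> h; elim: s => //= x s IH /orP[/h->//|/IH->]; rewrite orbT. Qed.

Lemma wf_trunc m k t : wf_at m t -> wf_at k (trunc_at k t).
Proof.
elim/tree_nested_ind: t m k => [A d|A d ts IH] m k /=.
  by case: (boolP (within k d)).
case/and4P => _ h1 h2 h3.
have hr : [&& atomic A, all (atomic \o concl) ts & ~~ f_value ts] ->
  [&& atomic A, all (atomic \o concl) [seq trunc_at k.+1 u | u <- ts]
    & ~~ f_value [seq trunc_at k.+1 u | u <- ts]].
  case/and3P=> -> h hf /=; rewrite all_map; apply/andP; split.
    by elim: ts h {IH h1 h2 h3 hf} => //= u us IHus /andP[hu /IHus ->]; rewrite concl_trunc hu.
  apply: contra hf; rewrite /f_value has_map; apply: has_sub => u /=.
  exact: f_labels_trunc.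
apply/and4P; split.
- by case: (boolP (within k d)).
- apply/implyP; rewrite /nilp size_map => /andP[hd hn]; apply: hr.
  by apply: (implyP h1); rewrite /nilp hn andbT; move: hd; case: ifP.
- apply/implyP => h; apply: hr; apply: (implyP h2); move: h.
  by rewrite /hg_value has_map; apply: has_sub => u /=; apply: hg_at_trunc.
- by elim: IH h3 {h1 h2 hr} => //= u us Hu _ IHus /andP[/Hu -> /IHus ->].
Qed.

Lemma wf_mono m k t : m <= k -> wf_at m t ->
  [/\ f_labels k t = [::], hg_at k t = false & wf_at k t].
Proof.
elim/tree_nested_ind: t m k => [A [j|]|A d ts IH] m k //= le.
  move=> lt; have -> : (Some j == Some k) = false.
    by apply/eqP => -[e]; move: lt; rewrite e ltnNge le.
  by split=> //; apply: leq_trans lt le.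
case/and4P => hd h1 h2 h3.
have {IH} h : [/\ flatten [seq f_labels k.+1 u | u <- ts] = [::],
   has (hg_at k.+1) ts = false & all (wf_at k.+1) ts].
  elim: IH h3 {h1 h2} => //= u us Hu _ IHus /andP[/(Hu m.+1 k.+1 le)[-> -> ->]].
  by case/IHus=> -> -> ->.
have {h} [-> -> ->] := h.
split=> //; last by rewrite h1 h2 !andbT; case: d hd {h1} => //= j /leq_trans->.
by case: d hd {h1} => //= j lt; rewrite orbF; apply/eqP => -[e]; move: lt; rewrite e ltnNge le.
Qed.

Section Subst.
Variable sigma : form -> tree.
Let good A := arg_structure (sigma A) /\ concl (sigma A) = A.

Lemma wf_subst k t :
  wf_at k t -> (forall A, A \in unzip1 (open_as k t) -> good A) ->
  [/\ wf_at k (subst sigma t), concl (subst sigma t) = concl t,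
      forall j, f_labels j (subst sigma t) = f_labels j t &
      forall j, hg_at j (subst sigma t) = hg_at j t].
Proof.
elim/tree_nested_ind: t k => [A [j|]|A d ts IH] k //=.
  move=> _ /(_ A); rewrite inE eqxx => /(_ isT) [w c].
  have h j := wf_mono (leq0n j) w; split=> //; by [have [] := h k|move=> j; have [] := h j].
case/and4P=> hd h1 h2 h3 hg.
have {h3} : [/\ all (wf_at k.+1) [seq subst sigma u | u <- ts],
  [seq concl (subst sigma u) | u <- ts] = [seq concl u | u <- ts],
  forall j, [seq f_labels j (subst sigma u) | u <- ts] = [seq f_labels j u | u <- ts] &
  forall j, [seq hg_at j (subst sigma u) | u <- ts] = [seq hg_at j u | u <- ts]].
  elim: IH h3 hg {h1 h2} => //= u us Hu _ IHus /andP[wu wus] hg.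
  have [|-> -> e1 e2] := Hu _ wu.
    by move=> B hB; apply: hg; rewrite /unzip1 map_cat mem_cat hB.
  have [//||-> -> e3 e4] := IHus _ .
    by move=> B hB; apply: hg; rewrite /unzip1 map_cat mem_cat hB orbT.
  by split=> // j; rewrite ?e1 ?e2 ?e3 ?e4.
case=> wf ec ef eh.
have fv : f_value [seq subst sigma u | u <- ts] = f_value ts.
  rewrite /f_value has_map -(has_map (f_labels 0) (fun l => l != [::])) -ef.
  by rewrite has_map.
have hv j : has (hg_at j) [seq subst sigma u | u <- ts] = has (hg_at j) ts.
  by rewrite has_map -[RHS](has_map (hg_at j) id) -eh has_map.
have av : all (atomic \o concl) [seq subst sigma u | u <- ts] = all (atomic \o concl) ts.
  by rewrite all_map -[RHS](all_map concl atomic) -ec all_map.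
split=> // [|j|j].
- by rewrite fv /hg_value hv av /nilp size_map hd wf h1 h2.
- by rewrite -map_comp (ef j.+1).
- by rewrite hv.
Qed.

Lemma closed_subst k t :
  wf_at k t -> (forall A, A \in unzip1 (open_as k t) -> closed (sigma A)) ->
  open_as k (subst sigma t) = [::].
Proof.
elim/tree_nested_ind: t k => [A [j|]|A d ts IH] k /=.
- by move=> ->.
- move=> _ /(_ A); rewrite inE eqxx closedE => /(_ isT) /eqP e.
  by rewrite -[k]add0n open_asD e.
case/and4P=> _ _ _ h3 hg; elim: IH h3 hg => //= u us Hu _ IHus /andP[wu wus] hg.
rewrite Hu //; last by move=> B hB; apply: hg; rewrite /unzip1 map_cat mem_cat hB.
by apply: IHus => // B hB; apply: hg; rewrite /unzip1 map_cat mem_cat hB orbT.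
Qed.

End Subst.

Lemma open_f_labels A j k t : (A, Some j) \in open_as k t -> A \in f_labels (j + k) t.
Proof.
elim/tree_nested_ind: t k => [B [i|]|B d ts IH] k //=.
- case: (ltnP i k) => //= ge; rewrite inE => /eqP [-> ->].
  by rewrite subnK // eqxx mem_head.
- by rewrite inE => /eqP.
elim: IH => //= u us Hu _ IHus; rewrite !mem_cat => /orP[/Hu|/IHus ->]; last by rewrite orbT.
by rewrite addnS => ->.
Qed.

Lemma max_seq_leP s m : reflect {in s, forall x, x <= m} (max_seq s <= m).
Proof.
apply: (iffP idP) => [h x|].
  elim: s h => [//|y s IH] /=; rewrite geq_max inE => /andP[hy hs] /orP[/eqP->//|].
  exact: IH.
elim: s => [//|y s IH] h /=; rewrite geq_max h ?mem_head // IH // => x xs.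
by apply: h; rewrite inE xs orbT.
Qed.

Lemma rank_closed D : closed D -> rank D = (height (concl D)).*2.
Proof.
move=> c; rewrite /rank c; move: c; rewrite closedE => /eqP ->.
by rewrite /= maxn0 addn0.
Qed.

Lemma rank_le D m : height (concl D) <= m ->
  {in unzip1 (open_as 0 D), forall A, height A <= m} -> rank D <= m.*2.+1.
Proof.
move=> hc ha; rewrite /rank -addn1; apply: leq_add; last by case: closed.
rewrite leq_double; apply/max_seq_leP => x /mapP [A]; rewrite inE => /orP[/eqP-> ->//|/ha h ->//].
Qed.

Lemma rank_open D : ~~ closed D ->
  (height (concl D)).*2 < rank D /\ {in asm D, forall A, (height A).*2 < rank D}.
Proof.
move=> nc; rewrite /rank nc addn1 !ltnS leq_double.
have /max_seq_leP h := leqnn (max_seq [seq height A | A <- concl D :: unzip1 (open_as 0 D)]).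
split; first by apply: h; rewrite /= mem_head.
move=> A; rewrite in_asm => hA; rewrite ltnS leq_double.
by apply: h; apply: map_f; rewrite inE hA orbT.
Qed.

Lemma open_immediate A ts : closed (Nd A None ts) ->
  List.Forall (fun t => forall B, B \in unzip1 (open_as 0 (substructure t)) ->
    B \in f_labels 0 t) ts.
Proof.
rewrite closedE /=; elim: ts => [//|t ts IH] /= h; constructor; last first.
  by apply: IH; move: h; case: (open_as 1 t).
move=> B; rewrite unzip1_open_as_trunc => /mapP [[C o] hx ->] /=.
have sh : {subset outward 1 C o <= open_as 1 t}.
  by move=> y hy; rewrite -[1]add0n open_asD; apply/flattenP; exists (outward 1 C o) => //;
     apply: (map_f (fun x => outward 1 x.1 x.2) hx).
have e : open_as 1 t = [::] by case: (open_as 1 t) h.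
case: o hx sh => [[|j]|] hx /=; rewrite e.
- by rewrite -[0]addn0; move: hx => /open_f_labels.
- by move=> /(_ (C, Some j.+1.-1)); rewrite subn1 mem_head => /(_ isT).
- by move=> /(_ (C, None)); rewrite mem_head => /(_ isT).
Qed.

Lemma immediate_rank D E : closed D -> closed E -> arg_structure E -> concl E = concl D ->
  canonical E ->
  List.Forall (fun t => arg_structure t /\ rank t < rank D) (immediate E).
Proof.
move=> cD cE wE e [[ts A] hi eE]; rewrite (rank_closed cD) -e.
move: cE wE; rewrite eE /associated /= => cE; rewrite /arg_structure /= => /andP[_ wts].
have hF := open_immediate cE; move: hi {e eE cE}.
rewrite /introduction /= => /and3P[_ _].
have key t m : wf_at 1 t -> height (concl t) <= m ->
    (forall B, B \in unzip1 (open_as 0 (substructure t)) -> height B <= m) ->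
    arg_structure (substructure t) /\ rank (substructure t) < m.+1.*2.
  move=> w h1 h2; split; first exact: wf_trunc w.
  rewrite doubleS ltnS; apply: rank_le => //; by rewrite concl_trunc.
have nf t us B : f_labels 0 t = [::] ->
    (forall B, B \in unzip1 (open_as 0 (substructure t)) -> B \in f_labels 0 t) ->
   B \in unzip1 (open_as 0 (substructure t)) -> us.
  by move=> e h /h; rewrite e.
move: wts hF; case: ts => [|t [|u [|? ?]]]; case: A => // X Y.
- rewrite /f_value /= andbT orbF => w /List.Forall_cons_iff [hF _] /andP[hc /negbNE /eqP f0].
  constructor=> //; apply: key w _ _ => [|B]; last exact: nf.
  by case/orP: hc => /eqP->; rewrite leq_max leqnn ?orbT.
- rewrite /= andbT => w /List.Forall_cons_iff [hF _] /andP[/eqP hc /allP hX].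
  constructor=> //; apply: key w _ _ => [|B /hF/hX/eqP->]; last exact: leq_maxl.
  by rewrite hc leq_maxr.
- rewrite /f_value /= andbT orbF => /andP[wt wu].
  move=> /List.Forall_cons_iff [ht /List.Forall_cons_iff [hu _]].
  case/and3P=> /eqP ct /eqP cu; rewrite negb_or => /andP[/negbNE/eqP ft /negbNE/eqP fu].
  constructor; last constructor=> //.
    by apply: key wt _ _ => [|B]; [rewrite ct leq_maxl|exact: nf].
  by apply: key wu _ _ => [|B]; [rewrite cu leq_maxr|exact: nf].
Qed.

Lemma validity_clauses_ext n V V' B J D : arg_structure D -> reductions J ->
  (forall C K E, arg_structure E -> reductions K -> rank E < rank D ->
     V C K E <-> V' C K E) ->
  validity_clauses n V B J D -> validity_clauses n V' B J D.
Proof.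
move=> wD hJ hV; rewrite /validity_clauses; case: ifP => cD.
  case: ifP => // _ [E [hred hcan hE]]; exists E; split=> //.
  have [wE cE sE] := reduces_inv hJ hred wD.
  have clE : closed E.
    move: cD; rewrite !closedE => /eqP e0; move: sE; rewrite e0.
    by case: (open_as 0 E) => // x s /(_ x); rewrite mem_head => /(_ isT).
  have := immediate_rank cD clE wE cE hcan.
  elim: hE => // t ts hVt _ IH /List.Forall_cons_iff [[wt rt] hts].
  by constructor; [apply/(hV _ _ _ wt hJ rt)|exact: IH].
have [rc ra] := rank_open (negbT cD).
move=> h sigma K C hs hcl hK JK hC hv.
have hs' A : A \in unzip1 (open_as 0 D) -> arg_structure (sigma A) /\ concl (sigma A) = A.
  by rewrite -in_asm; apply: hs.
have [w c _ _] := wf_subst wD hs'.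
have cl : closed (subst sigma D).
  by rewrite closedE (closed_subst wD) // => A hA; apply: hcl; rewrite in_asm.
apply/hV => //; first by rewrite rank_closed // c.
apply: h => // A hA; have [wA cA] := hs A hA.
apply/hV => //; last exact: hv.
by rewrite rank_closed ?cA; [exact: ra|exact: hcl].
Qed.

Lemma valid_iter n k B J D : arg_structure D -> reductions J -> rank D < k ->
  iter k (validity_clauses n) (fun _ _ _ => False) B J D <-> valid n B J D.
Proof.
rewrite /valid; elim: (k) {-2}k (leqnn k) B J D => [[]//|m IH] [//|j] le B J D wD hJ lt.
have IH' C K E i : arg_structure E -> reductions K -> rank E < i -> i <= m ->
    iter i (validity_clauses n) (fun _ _ _ => False) C K E <-> valid n C K E.
  by move=> wE hK h1 h2; apply: IH.
have h C K E : arg_structure E -> reductions K -> rank E < rank D ->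
  iter j (validity_clauses n) (fun _ _ _ => False) C K E <->
  iter (rank D) (validity_clauses n) (fun _ _ _ => False) C K E.
  move=> wE hK hr.
  have [h1 h2] := IH' C K E j wE hK (leq_trans hr lt) le.
  have [h3 h4] := IH' C K E (rank D) wE hK hr (leq_trans lt le).
  by split=> [/h1/h4|/h3/h2].
by split; apply: validity_clauses_ext => // C K E wE hK hr; apply: iff_sym; exact: h.
Qed.

Lemma validE n B J D : arg_structure D -> reductions J ->
  valid n B J D <-> validity_clauses n (valid n) B J D.
Proof.
move=> wD hJ; split; apply: validity_clauses_ext => // C K E wE hK lt;
  [|apply: iff_sym]; exact: valid_iter.
Qed.

(* Main.v *)
From Stdlib Require Import Relation_Operators.
From mathcomp Require Import all_boot finmap.
Require Import Defs.
Set Implicit Arguments. Unset Strict Implicit. Unset Printing Implicit Defensive.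

(** A reduction is only asked to preserve the conclusion, not to enlarge the set
of undischarged assumptions, and to commute with substitution. Closed structures
are fixed by every substitution, so for a closed structure [E] the map sending
every closed structure with the same conclusion as [E] to [E] is a reduction,
for the recursive rule consisting of all inferences. Hence, if [J] contains all
reductions, any two closed structures with the same conclusion reduce to each
other in one step with respect to [J] ([closed_reduces]), and the validity on a
base of a closed argument <[D], [J]> depends only on the conclusion of [D].

By induction on [A], two facts are proved together, for all bases of level at
most [n]: if [A] holds in the base, then every closed structure with conclusion
[A], paired with such a [J], is valid on it ([sat_valid]); and if any closed
argument for [A], with whatever reductions, is valid on the base, then [A]
holds in it ([valid_sat]). The interesting case is that of an implication
from [X] to [Y]. If it holds, the canonical structure inferring [Y] from [X]
in one step and then discharging [X] is valid: closed valid arguments for [X]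
witness that [X] holds in the extension at hand, hence so does [Y], and every
closed structure for [Y] is valid. Conversely, if [X] holds in an extension,
then the structure consisting of the axiom leaf [X] is valid on it with respect
to all reductions, and substituting it in the immediate sub-structure of a
canonical argument gives a valid closed argument for [Y]; if the discharge of
[X] is vacuous, that sub-structure is itself a valid closed argument for [Y],
and the truth of [Y] persists in extensions.

The theorem follows by applying the same reasoning to the one-step structure
inferring [A] from all the members of [Gamma]. *)

(** * Closed structures *)

Lemma subst_closed sigma k t : open_as k t = [::] -> subst sigma t = t.
Proof.
elim/tree_nested_ind: t k => [A [j|]|A d ts IH] k //= h; congr Nd.
elim: IH h => //= u us Hu _ IHus /eqP.
by rewrite -size_eq0 size_cat addn_eq0 !size_eq0 => /andP[/eqP /Hu -> /eqP /IHus ->].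
Qed.

Lemma trunc_wf k t : wf_at k t -> trunc_at k t = t.
Proof.
elim/tree_nested_ind: t k => [A d|A d ts IH] k /=; first by move=> ->.
case/and4P => -> _ _ h; congr Nd.
by elim: IH h => //= u us Hu _ IHus /andP[/Hu -> /IHus ->].
Qed.

(** A well-formed tree has no discharges above the root of the whole structure:
the rule applications not discharged below or at it are undischarged. *)
Lemma open_rules_None k t : wf_at k t -> {in open_rules k t, forall x, x.2 = None}.
Proof.
elim/tree_nested_ind: t k => [//|A d ts IH] k /= /and4P[hd _ _ h] x.
rewrite mem_cat => /orP[|].
  case: ifP => // _; case: d hd => [j /= ->//|_ /=].
  by rewrite inE => /eqP ->.
elim: IH h => //= u us Hu _ IHus /andP[/Hu hu /IHus hus].
by rewrite mem_cat => /orP[/hu|/hus].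
Qed.

Lemma inherits_open_rules t t' : arg_structure t -> arg_structure t' ->
  inherits (open_rules 0 t) (open_rules 0 t').
Proof.
move=> wt wt' x hx; have ex := open_rules_None wt' hx.
have [/mapP [y hy e]|] := boolP (x.1 \in unzip1 (open_rules 0 t)); last by right.
left; have ey := open_rules_None wt hy.
by move: hy; case: x {hx} ex e => x1 x2 /= -> ->; case: y ey => y1 y2 /= ->.
Qed.

Lemma asm_closed D : closed D -> asm D = fset0.
Proof. by move/eqP. Qed.

(** A closed structure is associated to an inference: its root is neither an
assumption leaf nor discharged. *)
Lemma closed_associated D : arg_structure D -> closed D ->
  exists i, D = associated i.
Proof.
rewrite closedE; case: D => [A [j|]|A [j|] ts] //= _ _.
by exists (ts, A).
Qed.

(** * Constant reductions between closed structures *)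

(** The map sending every closed structure with the same conclusion as [E] to
[E], undefined elsewhere. *)
Definition const_reduction (E : tree) : reduction_map := fun D =>
  if [&& arg_structure D, closed D & concl D == concl E] then Some E else None.

Lemma recursive_all : recursive (fun _ => True).
Proof.
exists (Comp Succ [:: Zero]) => i; split=> // _.
by apply: (@CComp _ _ _ [:: 0]); [constructor; constructor|exact: CSucc].
Qed.

Lemma const_reductionP E : arg_structure E -> closed E ->
  reduction (const_reduction E).
Proof.
move=> wE cE; exists (fun _ => True); first exact: recursive_all.
move=> D E'; rewrite {1}/const_reduction; case: ifP => // hD [<-].
case/and3P: (hD) => wD cD /eqP e.
have [i ei] := closed_associated wD cD.
split=> //; first by exists i.
  by rewrite (asm_closed cE) fsub0set e.
move=> sigma _; move: (cD) (cE); rewrite !closedE => /eqP oD /eqP oE.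
by rewrite (subst_closed _ oD) (subst_closed _ oE) /const_reduction hD.
Qed.

Lemma closed_reduces (J : map_set) D E : (forall phi, reduction phi -> J phi) ->
  arg_structure D -> closed D -> arg_structure E -> closed E ->
  concl E = concl D -> reduces J D E.
Proof.
move=> hJ wD cD wE cE e; apply: rt1n_trans (rt1n_refl _ _ _).
split=> //; apply: ICHere; exists (const_reduction E), E; split.
- exact/hJ/const_reductionP.
- by rewrite /substructure (trunc_wf wD) /const_reduction wD cD e eqxx.
- split; first exact: trunc_wf.
    by move: cE; rewrite closedE => /eqP ->.
  exact: inherits_open_rules.
Qed.

(** * Derivations and bases *)

Lemma derivation_inv B ctx t : derivation B ctx t ->
  exists ps A d ts, [/\ t = Nd (Atom A) d ts,
    if d is Some j then List.In (Rule ps A) (nth [::] ctx j) else B (Rule ps A) &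
    List.Forall2 (fun p u => concl u = Atom p.2 /\ derivation B (p.1 :: ctx) u) ps ts].
Proof. by case=> {}ctx ps A d ts h1 h2; exists ps, A, d, ts. Qed.

(** A derivation in a base is an argument structure without assumption leaves. *)
Lemma derivation_structure B ctx t : derivation B ctx t ->
  [/\ atomic (concl t), wf_at (size ctx) t, forall k, f_labels k t = [::] &
      forall k, open_as k t = [::]].
Proof.
elim/tree_nested_ind: t ctx => [A d|A d ts IH] ctx /derivation_inv.
  by case=> ps [a [d' [ts' []]]].
case=> ps [a [d' [ts' [[-> -> <-] hr hF]]]].
have hd : within (size ctx) d'.
  by case: d' hr => //= j; case: (ltnP j (size ctx)) => // /(nth_default [::]) ->.
have [ha hw hf ho] : [/\ all (atomic \o concl) ts, all (wf_at (size ctx).+1) ts,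
    forall k, [/\ flatten [seq f_labels k u | u <- ts] = [::] & ~~ f_value ts] &
    forall k, flatten [seq open_as k u | u <- ts] = [::]].
  elim: hF IH {hr} => //= p u {}ps us [_ hu] _ IHus /List.Forall_cons_iff [Hu /IHus [-> -> ef eo]].
  have [/= -> -> ff fo] := Hu _ hu.
  split=> // k; last by rewrite fo eo.
  have [-> ev] := ef k.
  by rewrite ff /f_value /= ff.
split=> //= [|k]; last by have [] := hf k.+1.
have [_ hv] := hf 0.
by rewrite hd ha hv hw !implybT.
Qed.

Lemma derivation_mono (B C : rule_set) ctx t : (forall R, B R -> C R) ->
  derivation B ctx t -> derivation C ctx t.
Proof.
move=> hBC; elim/tree_nested_ind: t ctx => [A d|A d ts IH] ctx /derivation_inv.
  by case=> ps [a [d' [ts' []]]].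
case=> ps [a [d' [ts' [[-> -> <-] hr hF]]]].
apply: (@Derivation _ _ ps); first by case: d' hr => [//|]; exact: hBC.
elim: hF IH {hr} => // p u {}ps us [e hu] _ IHus /List.Forall_cons_iff [Hu /IHus h].
by constructor=> //; split=> //; exact: Hu.
Qed.

Lemma extends_trans n B C D : extends n B C -> extends n C D -> extends n B D.
Proof. by move=> [h _] [h' hD]; split=> // R /h/h'. Qed.

Lemma sat_mono n B C A : extends n B C -> sat n B A -> sat n C A.
Proof.
move=> hC; elim: A => [a|X IHX Y IHY|X IHX Y IHY|X _ Y _] /=.
- by case=> D hD cD; exists D => //; apply: derivation_mono hD; case: hC.
- by case=> /IHX h /IHY.
- by case=> [/IHX|/IHY]; [left|right].
- by move=> h D hD; apply: h; apply: extends_trans hD.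
Qed.

(** * Validity of one-step structures and of instances *)

(** [D] is a closed argument structure with conclusion [A]. *)
Definition closed_for (A : form) (D : tree) : Prop :=
  [/\ arg_structure D, closed D & concl D = A].

(** The inference of [A] from the members of [s] in one step, without
discharges. For empty [s] it is the axiom leaf [A], which is closed even when
[A] is not atomic. *)
Definition step (s : seq form) (A : form) : tree :=
  Nd A None [seq As X None | X <- s].

Lemma step_structure s A : arg_structure (step s A).
Proof.
rewrite /arg_structure /= /hg_value has_map (eq_has (a2 := pred0)) // has_pred0 /=.
by rewrite all_map; apply/allP.
Qed.

Lemma open_step s A : unzip1 (open_as 0 (step s A)) = s.
Proof. by rewrite /=; elim: s => //= X s ->. Qed.

Lemma closed_for_leaf A : closed_for A (step [::] A).
Proof. by split; [exact: step_structure|rewrite closedE|]. Qed.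

(** A one-step structure with assumptions is valid as soon as, for every extension
and every larger set of reductions for which each assumption has a valid closed
argument, all closed structures for the conclusion are valid. *)
Lemma valid_step n B (J : map_set) X s A : reductions J ->
  (forall C (J' : map_set), extends n B C -> reductions J' ->
     (forall phi, J phi -> J' phi) ->
     (forall Y, Y \in X :: s -> exists2 D, closed_for Y D & valid n C J' D) ->
     forall D, closed_for A D -> valid n C J' D) ->
  valid n B J (step (X :: s) A).
Proof.
move=> hJ h; have w := step_structure (X :: s) A.
apply/(validE _ _ w hJ); rewrite /validity_clauses.
case: ifP => [|_ sigma J' C hs hcl hJ' JJ' hC hv]; first by rewrite closedE.
have mem Y : (Y \in asm (step (X :: s) A)) = (Y \in X :: s) by rewrite in_asm open_step.
apply: h => // [Y|].
  rewrite -mem => hY.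
  by exists (sigma Y); [split; [case: (hs Y hY)|exact: hcl|case: (hs Y hY)]|exact: hv].
have hg Y : Y \in unzip1 (open_as 0 (step (X :: s) A)) ->
  arg_structure (sigma Y) /\ concl (sigma Y) = Y by rewrite -in_asm; exact: hs.
have [w' e _ _] := wf_subst w hg.
split=> //; rewrite closedE (closed_subst w) // => Y hY.
by apply: hcl; rewrite in_asm.
Qed.

(** The closed argument is obtained by substituting axiom leaves for the
assumptions of [D]. *)
Lemma valid_instance n B C (J J' : map_set) D :
  arg_structure D -> reductions J -> valid n B J D -> ~~ closed D ->
  extends n B C -> reductions J' -> (forall phi, J phi -> J' phi) ->
  (forall X, X \in asm D -> valid n C J' (step [::] X)) ->
  exists2 E, closed_for (concl D) E & valid n C J' E.
Proof.
move=> w hJ /(validE _ _ w hJ) + nc; rewrite /validity_clauses (negbTE nc) => h.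
move=> hC hJ' JJ' hv.
have hs Y : arg_structure (step [::] Y) /\ concl (step [::] Y) = Y.
  by case: (closed_for_leaf Y).
have hc Y : closed (step [::] Y) by case: (closed_for_leaf Y).
exists (subst (step [::]) D); last by apply: h.
have [w' e _ _] := wf_subst w (fun Y _ => hs Y).
by split=> //; rewrite closedE (closed_subst w).
Qed.

(** * Validity of closed arguments and truth in a base *)

Lemma reductions_all : reductions reduction.
Proof. by []. Qed.

(** Truth of [A] makes all closed arguments for [A] valid, when every reduction
is available. *)
Definition sat_to_valid (n : nat) (A : form) : Prop :=
  forall B (J : map_set) D, base_le n B -> reductions J ->
    (forall phi, reduction phi -> J phi) -> sat n B A -> closed_for A D -> valid n B J D.

(** Some closed argument for [A] being valid, with any set of reductions, makes
[A] true. *)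
Definition valid_to_sat (n : nat) (A : form) : Prop :=
  forall B (J : map_set) D, base_le n B -> reductions J ->
    closed_for A D -> valid n B J D -> sat n B A.

(** When [J] contains all reductions, one closed canonical structure for [A] with
valid immediate sub-structures makes every closed structure for [A] valid. *)
Lemma valid_canonical n B (J : map_set) D ts A : reductions J ->
  (forall phi, reduction phi -> J phi) -> ~~ atomic A -> closed_for A D ->
  introduction (ts, A) -> closed (associated (ts, A)) ->
  List.Forall (fun t => valid n B J (substructure t)) ts ->
  valid n B J D.
Proof.
move=> hJ aJ nA [wD cD eD] hi cE hts; apply/(validE _ _ wD hJ).
rewrite /validity_clauses cD eD (negbTE nA); exists (associated (ts, A)); split.
- by apply: closed_reduces => //; case/and3P: hi.
- by exists (ts, A).
- exact/List.Forall_map.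
Qed.

(** The canonical structure to which a closed valid argument reduces is closed and
has the same conclusion. *)
Lemma canonical_of_valid n B J D A : reductions J -> ~~ atomic A ->
  closed_for A D -> valid n B J D ->
  exists ts, [/\ introduction (ts, A), closed (associated (ts, A)) &
    List.Forall (fun t => valid n B J (substructure t)) ts].
Proof.
move=> hJ nA [wD cD eD] /(validE _ _ wD hJ).
rewrite /validity_clauses cD eD (negbTE nA) => -[E [hred [[ts A'] hi eE] hF]].
have [_ cE sE] := reduces_inv hJ hred wD.
have eA : A' = A by rewrite -eD -cE eE.
rewrite eA in hi eE; exists ts; split=> //.
  rewrite -eE closedE; move: cD sE; rewrite closedE => /eqP ->.
  by case: (open_as 0 E) => // x s /(_ x); rewrite mem_head => /(_ isT).
by move: hF; rewrite eE => /List.Forall_map.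
Qed.

Lemma sat_valid_atom n a : sat_to_valid n (Atom a) /\ valid_to_sat n (Atom a).
Proof.
split=> B J D hB hJ.
  move=> aJ [E hE eE] [wD cD eD]; apply/(validE _ _ wD hJ).
  rewrite /validity_clauses cD eD; exists E => //.
  have [_ wE _ oE] := derivation_structure hE.
  by apply: closed_reduces; rewrite // ?closedE ?oE // eE.
case=> wD cD eD /(validE _ _ wD hJ); rewrite /validity_clauses cD eD /=.
case=> E hred hE; exists E => //.
by have [_ -> _] := reduces_inv hJ hred wD.
Qed.

(** An immediate sub-structure of a closed structure is closed if the last
inference discharges no assumption in it. *)
Lemma closed_for_immediate A t ts : closed (Nd A None ts) -> wf_at 1 t ->
  List.In t ts -> f_labels 0 t = [::] -> closed_for (concl t) (substructure t).
Proof.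
move=> c w ht ft; split; [exact: wf_trunc w| |exact: concl_trunc].
have /List.Forall_forall /(_ t ht) := open_immediate c.
rewrite ft closedE; case: open_as => // x s /(_ x.1).
by rewrite /= mem_head => /(_ isT).
Qed.

Lemma sat_valid_and n X Y : sat_to_valid n X -> valid_to_sat n X ->
  sat_to_valid n Y -> valid_to_sat n Y ->
  sat_to_valid n (And X Y) /\ valid_to_sat n (And X Y).
Proof.
move=> svX vsX svY vsY; split=> B J D hB hJ.
  move=> aJ [hX hY] hD.
  apply: (@valid_canonical _ _ _ _ [:: step [::] X; step [::] Y] _ hJ aJ _ hD) => //.
  - by rewrite /introduction /= !eqxx.
  - by rewrite closedE.
  - by do !constructor; [apply: svX|apply: svY] => //; exact: closed_for_leaf.
move=> hD /(canonical_of_valid (A := And X Y) hJ isT hD) [ts [hi cE hF]].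
move: hi; rewrite /introduction => /and3P [/and4P [_ _ _ /=]].
case: ts cE hF => [|t [|u [|? ?]]] //= cE hF.
case/and3P=> wt wu _ _ /and3P [/eqP et /eqP eu].
rewrite /f_value /= orbF negb_or => /andP[/negbNE/eqP ft /negbNE/eqP fu].
case/List.Forall_cons_iff: hF => vt /List.Forall_cons_iff [vu _].
split.
  apply: vsX vt => //; rewrite -et.
  by apply: closed_for_immediate cE _ _ _ => //; left.
apply: vsY vu => //; rewrite -eu.
by apply: closed_for_immediate cE _ _ _ => //; right; left.
Qed.

Lemma sat_valid_or n X Y : sat_to_valid n X -> valid_to_sat n X ->
  sat_to_valid n Y -> valid_to_sat n Y ->
  sat_to_valid n (Or X Y) /\ valid_to_sat n (Or X Y).
Proof.
move=> svX vsX svY vsY; split=> B J D hB hJ.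
  move=> aJ h hD.
  have key Z : (Z == X) || (Z == Y) -> valid n B J (step [::] Z) -> valid n B J D.
    move=> hZ vZ.
    apply: (@valid_canonical _ _ _ _ [:: step [::] Z] _ hJ aJ _ hD) => //.
    - by rewrite /introduction /= hZ.
    - by rewrite closedE.
    - by constructor.
  case: h => [hX|hY].
    by apply: (key X); [rewrite eqxx|apply: svX => //; exact: closed_for_leaf].
  by apply: (key Y); [rewrite eqxx orbT|apply: svY => //; exact: closed_for_leaf].
move=> hD /(canonical_of_valid (A := Or X Y) hJ isT hD) [ts [hi cE hF]].
move: hi; rewrite /introduction => /and3P [/and4P [_ _ _ /=]].
case: ts cE hF => [|t [|? [|? ?]]] //= cE hF.
rewrite andbT => wt _ /andP[et].
rewrite /f_value /= orbF => /negbNE/eqP ft.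
case/List.Forall_cons_iff: hF => vt _.
have ht : closed_for (concl t) (substructure t).
  by apply: closed_for_immediate cE _ _ _ => //; left.
case/orP: et => /eqP et; rewrite et in ht.
  by left; apply: vsX vt.
by right; apply: vsY vt.
Qed.

Lemma sat_valid_imp n X Y : sat_to_valid n X -> valid_to_sat n X ->
  sat_to_valid n Y -> valid_to_sat n Y ->
  sat_to_valid n (Imp X Y) /\ valid_to_sat n (Imp X Y).
Proof.
move=> svX vsX svY vsY; split=> B J D hB hJ.
  move=> aJ h hD.
  (* [Some 1] discharges [X] at the root, the parent of the node [Y]. *)
  apply: (@valid_canonical _ _ _ _ [:: Nd Y None [:: As X (Some 1)]] _ hJ aJ _ hD) => //.
  - by rewrite /introduction /= !eqxx.
  - by rewrite closedE.
  constructor=> //; apply: (@valid_step _ _ _ X [::] Y) => // C J' hC hJ' JJ' hv E hE.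
  have [F hF vF] := hv X (mem_head _ _).
  have [_ hC'] := hC.
  apply: svY => //; first by move=> phi /aJ /JJ'.
  exact/h/(vsX _ _ _ hC' hJ' hF).
move=> hD /(canonical_of_valid (A := Imp X Y) hJ isT hD) [ts [hi cE hF]] C hC sX.
move: hi; rewrite /introduction => /and3P [/and4P [_ _ _ /=]].
case: ts cE hF => [|t [|? [|? ?]]] //= cE /List.Forall_cons_iff [vt _].
rewrite andbT => wt _ /andP[/eqP et /allP ft].
have w : arg_structure (substructure t) by exact: wf_trunc wt.
have e : concl (substructure t) = Y by rewrite concl_trunc.
have [_ hC'] := hC.
have [c|nc] := boolP (closed (substructure t)).
  by apply: sat_mono hC _; apply: vsY vt.
have := valid_instance w hJ vt nc hC reductions_all hJ; rewrite e => h.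
have [Z hZ|E hE vE] := h; last by apply: vsY vE.
have /List.Forall_cons_iff [/(_ Z) hZ' _] := open_immediate cE.
rewrite in_asm in hZ; move/hZ'/ft/eqP: hZ => ->.
by apply: svX => //; exact: closed_for_leaf.
Qed.

Lemma sat_valid_both n A : sat_to_valid n A /\ valid_to_sat n A.
Proof.
elim: A => [a|X [??] Y [??]|X [??] Y [??]|X [??] Y [??]].
- exact: sat_valid_atom.
- exact: sat_valid_and.
- exact: sat_valid_or.
- exact: sat_valid_imp.
Qed.

Lemma sat_valid n A : sat_to_valid n A.
Proof. by case: (sat_valid_both n A). Qed.

Lemma valid_sat n A : valid_to_sat n A.
Proof. by case: (sat_valid_both n A). Qed.

Theorem theorem1 (n : nat) (B : rule_set) (hB : base_le n B)
    (Gamma : {fset form}) (A : form) :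
  entails n B Gamma A <-> arg_entails n B Gamma A.
Proof.
split=> [h|[D [J [wD hJ [aD cD] vD]]]].
  exists (step (enum_fset Gamma) A), reduction; split=> //.
  - exact: step_structure.
  - by split=> //; apply/fsetP => X; rewrite in_asm open_step.
  have mem X : X \in enum_fset Gamma = (X \in Gamma) by [].
  move: h; rewrite /entails; case: (enum_fset Gamma) mem => [|X s] mem.
    have -> : Gamma == fset0 by apply/eqP/fsetP => X; rewrite -mem inE.
    by move=> h; apply: (sat_valid hB _ _ h (closed_for_leaf A)).
  have -> /= : (Gamma == fset0) = false.
    by apply/negbTE/fset0Pn; exists X; rewrite -mem mem_head.
  move=> h.
  apply: valid_step => // C J' hC hJ' JJ' hv E hE.
  have [_ hC'] := hC.
  apply: (sat_valid hC' hJ' JJ' _ hE); apply: h => // Y.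
  by rewrite -mem => /hv [F hF vF]; apply: (valid_sat hC' hJ' hF vF).
rewrite /entails; have [G0|nG] := eqVneq.
  by apply: (valid_sat hB hJ _ vD); split=> //; rewrite /closed aD G0.
move=> C hC hs; have [_ hC'] := hC.
have nc : ~~ closed D by rewrite /closed aD.
have := valid_instance wD hJ vD nc hC reductions_all hJ; rewrite aD cD.
case=> [X hX|E hE vE]; last exact: (valid_sat hC' reductions_all hE vE).
exact: (sat_valid hC' reductions_all _ (hs X hX) (closed_for_leaf X)).
Qed.
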